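(* Let $s,t\geq 1$ be integers and let $p,q,l$ be three distinct primes with $p,q$ odd, $p\equiv 3 \pmod 4$, $\mathrm{ord}_{p^s}(l)=\phi(p^s)/2$, $\mathrm{ord}_{q^t}(l)=\phi(q^t)$ and $\gcd(\phi(p^s),\phi(q^t))=2$. Let $0\leq i<i'\leq s-1$ and $0\leq j\leq t-1$. Then in the ring $\mathbb{F}_l[x]/\langle x^{p^sq^t}-1\rangle$: (i) If $q$ is a quadratic residue modulo $p$, then \[\chi_{ij}^*\chi_{i'j}^*=\frac{\phi(p^{s-i'})}{2}(q-2)q^{t-j-1}\chi_{ij}^*+\frac{\phi(p^{s-i'})}{2}\phi(q^{t-j})\sum_{j<m\leq t}\chi_{im}^*.\] (ii) If $q$ is a quadratic nonresidue modulo $p$, then \[ \chi_{ij}^*\chi_{i'j}^*=\frac{\phi(p^{s-i'})}{2}(q-2)q^{t-j-1}\chi_{ij}^*+\frac{\phi(p^{s-i'})}{2}\phi(q^{t-j})\Big(\sum_{\substack{j<m\leq t\\2\nmid m-j}}\chi_{im}+\sum_{\substack{j<m\leq t\\2\mid m-j}}\chi_{im}^*\Big). \]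
   Context: Here $\phi$ is Euler's phi function (with $\phi(1)=1$) and $\mathrm{ord}_m(k)$ is the multiplicative order of $k$ modulo $m$. Put $n=p^sq^t$. Fix an integer $g$ that is a primitive root both modulo $p^s$ and modulo $q^t$. For an integer $\gamma$, $C_\gamma=\{\gamma l^r \bmod n: r\geq 0\}\subseteq \mathbb{Z}_n$ is the $l$-cyclotomic coset modulo $n$ containing $\gamma$. For $0\leq i\leq s$, $0\leq j\leq t$ set $C_{ij}=C_{p^iq^j}$ and $C_{ij}^*=C_{p^iq^jg}$. Define elements of $\mathbb{F}_l[x]/\langle x^{n}-1\rangle$ by $\chi_{ij}=\sum_{\alpha\in C_{ij}}x^\alpha$ and $\chi_{ij}^*=\sum_{\alpha\in C_{ij}^*}x^\alpha$. Integer coefficients are read in $\mathbb{F}_l$, and empty sums are $0$. *)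

(* Defs.v *)
From HB Require Import structures.
From mathcomp Require Import all_boot all_order all_fingroup all_algebra.
From mathcomp Require Import boolp.
Set Implicit Arguments.
Unset Strict Implicit.
Unset Printing Implicit Defensive.
Import GRing.Theory.
Local Open Scope ring_scope.

(* Multiplicative order of k modulo m, with value 0 when k is not invertible
   modulo m.  Only meaningful for m > 1, since 'Z_0 and 'Z_1 are both Z/2. *)
Definition mulord (m : nat) (k : int) : nat :=
  if (insub (k%:~R : 'Z_m) : option {unit 'Z_m}) is Some u
  then #[u]%g else 0%N.

Definition primitive_root_mod (m : nat) (g : int) : Prop :=
  coprimez g m%:Z /\ mulord m g = totient m.

Definition quadratic_residue (a m : nat) : Prop :=
  coprime a m /\ exists x : nat, (x ^ 2 = a %[mod m])%N.

Definition quadratic_nonresidue (a m : nat) : Prop :=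
  coprime a m /\ ~ exists x : nat, (x ^ 2 = a %[mod m])%N.

Definition cyclotomic_coset (l n : nat) (gamma : int) : {set 'I_n} :=
  [set a : 'I_n | `[< exists r : nat,
     (a : nat)%:Z = ((gamma * l%:Z ^+ r)%R %% n%:Z)%Z >]].

(* For n > 0 the modulus is monic and non-constant, so that {poly %/ _} is the
   genuine quotient; 'F_l has l elements when l is prime. *)
Notation cyclic_ring l n := {poly %/ ('X^n - 1 : {poly 'F_l})} (only parsing).

Definition coset_sum (l n : nat) (gamma : int) : cyclic_ring l n :=
  \sum_(a in cyclotomic_coset l n gamma) 'qX ^+ (a : nat).

Definition chi (p s q t l i j : nat) : cyclic_ring l (p ^ s * q ^ t) :=
  coset_sum l (p ^ s * q ^ t) (p ^ i * q ^ j)%N%:Z.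

Definition chi_star (p s q t l : nat) (g : int) (i j : nat) :
    cyclic_ring l (p ^ s * q ^ t) :=
  coset_sum l (p ^ s * q ^ t) ((p ^ i * q ^ j)%N%:Z * g).

(* Main.v *)
Require Import Defs.
From mathcomp Require Import all_boot all_order all_fingroup all_algebra.
From mathcomp Require Import cyclic boolp ring.
Import GRing.Theory.
Local Open Scope ring_scope.

(** By the Chinese remainder theorem, and because [l] has coprime orders modulo
    [P = p ^ s] and [Q = q ^ t], the coset of [gamma] is the product of
    [gamma <l>] mod [P] and [gamma <l>] mod [Q], so its sum factors as [U * V]
    with [U] a sum of powers of [u], [V] a sum of powers of [v], [u ^ P = 1] and
    [v ^ Q = 1].  Modulo [P], [H = <l>] has index 2 and odd order: it misses [-1]
    and contains every unit congruent to 1 mod [p].  Hence for [i < i'] the set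
    [A = p ^ i c H] is stable under translation by the elements of
    [A' = p ^ i' c' H], so that [U_A * U_A' = #|A'| U_A].  Modulo [Q], [<l>] is
    the group of all units, and [q ^ m <l>] is the difference of the ideals
    generated by [q ^ m] and [q ^ m.+1], whose power sums multiply trivially.
    Finally, [q] is a square mod [p] iff it lies in [H], which decides whether
    [q ^ m g H] is [q ^ j g H], or is so only for [m - j] even. *)

(** * Sums of powers of a root of unity over subsets of Z/N *)

Section PowerSum.
Variables (R : comNzRingType) (N : nat) (u : R).
Hypotheses (N_gt1 : (1 < N)%N) (uN : u ^+ N = 1).
Implicit Types A B : {set 'Z_N}.

Definition power_sum A : R := \sum_(a in A) u ^+ (a : nat).

Lemma expr_Zp_nat k : u ^+ (k%:R : 'Z_N) = u ^+ k.
Proof. by rewrite val_Zp_nat // -[RHS](expr_mod _ uN). Qed.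

Lemma expr_ZpD (a b : 'Z_N) : u ^+ (a + b)%R = u ^+ a * u ^+ b.
Proof. by rewrite -exprD -[in RHS]expr_Zp_nat natrD !natr_Zp. Qed.

(** Translation by [b] is injective, so it permutes the finite set [A]; hence multiplying
    [power_sum A] by any [u ^+ b] leaves it unchanged. *)
Lemma power_sumM A B : {in A & B, forall a b, a + b \in A} ->
  power_sum A * power_sum B = power_sum A *+ #|B|.
Proof.
move=> AB; rewrite [in LHS]/power_sum big_distrr /= -sumr_const.
apply: eq_bigr => b bB.
have defA : [set a + b | a in A] = A.
  apply/eqP; rewrite eqEcard card_imset ?leqnn ?andbT; last exact: addIr.
  by apply/subsetP=> _ /imsetP[a aA ->]; apply: AB.
rewrite -[in RHS]defA /power_sum big_imset /=; last by move=> ? ? _ _ /addIr.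
by rewrite big_distrl; apply: eq_bigr => a _; rewrite expr_ZpD.
Qed.

Lemma power_sumD A B : B \subset A ->
  power_sum (A :\: B) = power_sum A - power_sum B.
Proof.
move=> /setIidPr BA; apply/eqP; rewrite eq_sym subr_eq addrC.
by rewrite {1}/power_sum (big_setID B) BA.
Qed.

End PowerSum.

(** * Ideals of Z/N generated by divisors of N *)

Section Multiples.
Variables (N : nat).
Hypotheses (N_gt1 : (1 < N)%N).
Implicit Types d : nat.

Definition multiples d : {set 'Z_N} := [set x : 'Z_N | d %| x]%N.

Lemma dvdn_Zp d k : (d %| N)%N -> (d %| (k%:R : 'Z_N))%N = (d %| k)%N.
Proof. by move=> dN; rewrite val_Zp_nat // /dvdn modn_dvdm. Qed.

Lemma multiplesD d (x y : 'Z_N) : (d %| N)%N ->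
  x \in multiples d -> y \in multiples d -> x + y \in multiples d.
Proof.
move=> dN; rewrite !inE -{2}[x]natr_Zp -{2}[y]natr_Zp -natrD dvdn_Zp //.
exact: dvdn_add.
Qed.

Lemma multiples_sub d e : (d %| e)%N -> multiples e \subset multiples d.
Proof. by move=> de; apply/subsetP=> x; rewrite !inE; apply: dvdn_trans. Qed.

Lemma multiplesP d (x : 'Z_N) : x \in multiples d -> exists y : 'Z_N, x = d%:R * y.
Proof.
rewrite inE => /dvdnP[k xE]; exists k%:R.
by rewrite -natrM mulnC -xE natr_Zp.
Qed.

Lemma multiplesMn d (y : 'Z_N) : (d %| N)%N -> d%:R * y \in multiples d.
Proof. by move=> dN; rewrite inE -[y]natr_Zp -natrM dvdn_Zp // dvdn_mulr. Qed.

Lemma card_multiples d : (d %| N)%N -> #|multiples d| = (N %/ d)%N.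
Proof.
move=> dN; have N0 : (0 < N)%N by exact: ltnW.
have d0 : (0 < d)%N by apply: dvdn_gt0 dN.
have small (k : 'I_(N %/ d)) : (d * k < N)%N.
  by rewrite -[ltnRHS](divnK dN) mulnC ltn_pmul2r.
have -> : multiples d = [set (d * k)%:R | k : 'I_(N %/ d)].
  apply/setP=> x; rewrite inE; apply/idP/imsetP => [|[k _ ->]]; last first.
    by rewrite dvdn_Zp // dvdn_mulr.
  case/dvdnP=> k xE.
  have kN : (k < N %/ d)%N.
    rewrite -(ltn_pmul2r d0) -xE divnK // -[ltnRHS](Zp_cast N_gt1).
    exact: ltn_ord.
  by exists (Ordinal kN); rewrite //= mulnC -xE natr_Zp.
rewrite card_in_imset ?card_ord // => k1 k2 _ _ /(congr1 val) /=.
rewrite !val_Zp_nat // !modn_small ?small // => /eqP.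
by rewrite eqn_pmul2l // => /eqP /val_inj.
Qed.

Lemma Zp_int_eq0 (x : int) : ((x%:~R : 'Z_N) == 0) = (N %| x)%Z.
Proof.
have nat_eq0 k : ((k%:R : 'Z_N) == 0) = (N %| k)%N.
  by rewrite -val_eqE /= val_Zp_nat.
by case: x => k; rewrite ?NegzE ?mulrNz ?oppr_eq0 -pmulrn nat_eq0 // dvdzE abszN.
Qed.

End Multiples.

(** * Powers of 1 + pz, subgroups of index 2, and dilates *)

Lemma one_addM_exp (R : comNzRingType) (p : nat) (z : R) k :
  exists z', (1 + p%:R * z) ^+ (p ^ k) = 1 + (p ^ k.+1)%:R * z'.
Proof.
have pow1 (y : R) i : exists y', (1 + y) ^+ i = 1 + y * y'.
  exists (\sum_(j < i) (1 + y) ^+ j).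
  by apply/eqP; rewrite [eqbRHS]addrC -subr_eq subrX1 [1 + _]addrC addrK.
elim: k => [|k [y IH]]; first by exists z; rewrite expr1.
rewrite expnSr exprM IH expnS natrM -mulrA.
(* Here [(1 + p w)^p - 1] is [p w] times the sum of the [(1 + p w)^j], [j < p]. Each term is
   [1 + p w f_j], so the sum yields one more factor [p]. *)
set w := (p ^ k)%:R * y; have [f fE] := choice (pow1 (p%:R * w)).
exists (y * (1 + w * \sum_(j < p) f j)).
apply/eqP; rewrite [eqbRHS]addrC -subr_eq subrX1 [1 + _ in X in X * _]addrC addrK.
under eq_bigr => j _ do rewrite fE.
rewrite big_split /= sumr_const card_ord -mulr_sumr.
rewrite -[X in X + _]mulr1 -!mulrA -mulrDr expnSr natrM expnS natrM /w.
by rewrite -!mulrA [y * (p%:R * _)]mulrCA.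
Qed.

(** By cardinality, [G] is the disjoint union of [H] and [x^-1 H], and [y] must lie in the second
    coset. *)
Lemma index2_mulg (gT : finGroupType) (G H : {group gT}) (x y : gT) :
  (H \subset G -> #|G| = 2 * #|H| -> x \in G -> y \in G ->
  x \notin H -> y \notin H -> (x * y)%g \in H)%N.
Proof.
move=> sHG cG xG yG xH yH.
have dis : [disjoint H & (x^-1 *: H)%g].
  apply/pred0P=> z /=; apply/negP=> /andP[zH]; rewrite mem_lcoset invgK => xzH.
  by case/negP: xH; rewrite -(groupMr x zH).
have /eqP defG : H :|: (x^-1 *: H)%g == G :> {set gT}.
  rewrite eqEcard subUset sHG -{1}(lcoset_id (groupVr xG)) mulgS //=.
  move: dis; rewrite -leq_card_setU => /eqP ->.
  by rewrite card_lcoset cG mul2n addnn.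
by move: yG; rewrite -defG in_setU (negPf yH) /= mem_lcoset invgK.
Qed.

(** An orbit rather than a coset: [c] may be a zero divisor, and then [h |-> c h] can fail to be
    injective. *)
Definition dilate N (H : {set {unit 'Z_N}}) (c : 'Z_N) : {set 'Z_N} :=
  [set c * val h | h in H].
Arguments dilate {N}.

Lemma dilate_eq N (H : {group {unit 'Z_N}}) (c : 'Z_N) (h : {unit 'Z_N}) :
  h \in H -> dilate H (c * val h) = dilate H c.
Proof.
move=> hH; apply/setP=> x; apply/imsetP/imsetP => -[k kH ->].
  by exists (h * k)%g; rewrite ?groupM //= mulrA.
exists (h^-1 * k)%g; rewrite ?groupM ?groupV //= -mulrA [_ * (_ * val k)]mulrA.
by rewrite divrr ?mul1r // (valP h).
Qed.

(** * Layers of fixed p-adic valuation in Z/p^s *)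

Section PrimePower.
Variables (p s : nat).
Hypotheses (p_pr : prime p) (s_gt0 : (0 < s)%N).
Let N := (p ^ s)%N.
Implicit Types (x y z : 'Z_N) (m : nat).

Lemma pfactor_gt1 : (1 < N)%N.
Proof. by rewrite -(exp1n s) ltn_exp2r ?prime_gt1. Qed.
Let N_gt1 := pfactor_gt1.

Lemma unit_pfactor x : (x \is a GRing.unit) = ~~ (p %| x)%N.
Proof. by rewrite -[in LHS](natr_Zp x) unitZpE // coprime_pexpl // prime_coprime. Qed.

Lemma dvdn_pfactorM m x : (m < s)%N ->
  (p ^ m.+1 %| ((p ^ m)%:R * x : 'Z_N)%R)%N = (p %| x)%N.
Proof.
move=> ms; rewrite -[in LHS](natr_Zp x) -natrM dvdn_Zp ?dvdn_exp2l //.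
by rewrite expnSr dvdn_pmul2l // expn_gt0 prime_gt0.
Qed.

Lemma dvdn_pfactorM_eq0 m x : (m < s)%N -> (p ^ m)%:R * x = 0 -> (p %| x)%N.
Proof. by move=> ms x0; rewrite -(dvdn_pfactorM _ _ ms) x0 dvdn0. Qed.

Lemma mulr_unit_layer m x : (m < s)%N ->
  (x \in multiples N (p ^ m) :\: multiples N (p ^ m.+1)) =
  [exists u : {unit 'Z_N}, x == (p ^ m)%:R * val u].
Proof.
move=> ms; rewrite inE.
apply/andP/existsP => [[xN /multiplesP[y xE]]|[u /eqP ->]].
  move: xN; rewrite {}xE inE dvdn_pfactorM // -unit_pfactor => yU.
  by exists (FinRing.Unit yU).
rewrite multiplesMn ?dvdn_exp2l // 1?ltnW // inE dvdn_pfactorM // -unit_pfactor.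
by split=> //; apply: (valP u).
Qed.

Lemma card_layer m : (m < s)%N ->
  #|multiples N (p ^ m) :\: multiples N (p ^ m.+1)| = totient (p ^ (s - m)).
Proof.
move=> ms; rewrite cardsDS ?multiples_sub ?dvdn_exp2l //.
rewrite !card_multiples ?dvdn_exp2l // 1?ltnW // -!expnB ?prime_gt0 // 1?ltnW //.
rewrite totient_pfactor ?subn_gt0 // subnS.
rewrite -[in (p ^ (s - m))%N](prednK (n := s - m)) ?subn_gt0 //.
by rewrite expnS -(subn1 p) mulnBl mul1n.
Qed.

End PrimePower.

(** * An index 2 subgroup of odd order in the units modulo p^s *)

Section IndexTwo.
Variables (p s : nat).
Hypotheses (p_pr : prime p) (p_odd : odd p) (s_gt0 : (0 < s)%N).
Let N := (p ^ s)%N.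
Variable H : {group {unit 'Z_N}}.
Hypotheses (H_odd : odd #|H|) (cardH : totient N = (2 * #|H|)%N).
Implicit Types (h k w c : {unit 'Z_N}) (y z : 'Z_N) (i m : nat).

Let N_gt1 : (1 < N)%N := pfactor_gt1 _ _ p_pr s_gt0.

Lemma index2_unit_mul h k : h \notin H -> k \notin H -> (h * k)%g \in H.
Proof.
apply: (index2_mulg _ [set: {unit 'Z_N}]); rewrite ?inE ?subsetT //.
by rewrite -cardH -card_units_Zp // ltnW.
Qed.

Lemma index2_unit_sqr h : (h ^+ 2)%g \in H.
Proof.
rewrite expgS expg1; case: (boolP (h \in H)) => [hH|hH].
  exact: groupM.
exact: index2_unit_mul.
Qed.

(** All squares lie in [H], so [h] and its odd power [h ^+ n] lie in the same coset of [H]. *)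
Lemma index2_odd_order h n : odd n -> (h ^+ n = 1)%g -> h \in H.
Proof.
move=> n_odd hn; have nE : n = (2 * n./2).+1.
  by rewrite -[LHS]odd_double_half n_odd mul2n.
rewrite -(groupMr _ (_ : (h ^+ 2) ^+ n./2 \in H)%g).
  by rewrite -expgM -expgS -nE hn group1.
by rewrite groupX ?index2_unit_sqr.
Qed.

Lemma one_addM_pfactor z : (1 + p%:R * z : 'Z_N) ^+ (p ^ s) = 1.
Proof.
have [z' ->] := one_addM_exp _ p z s.
by rewrite expnS natrM -/N pchar_Zp // mulr0 mul0r addr0.
Qed.

Lemma index2_one_addM h z : val h = 1 + p%:R * z -> h \in H.
Proof.
move=> hE; apply: (index2_odd_order _ (p ^ s)); first by rewrite oddX p_odd orbT.
by apply: val_inj; rewrite FinRing.val_unitX hE one_addM_pfactor.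
Qed.

Let e : {unit 'Z_N} := FinRing.Unit (unitrN1 'Z_N).

(** Otherwise -1 raised to the odd power [#|H|] would be 1, whereas [N > 2]. *)
Let eNH : e \notin H.
Proof.
apply/negP=> /expg_cardG /(congr1 val).
rewrite FinRing.val_unitX /= -signr_odd H_odd expr1 => /eqP.
rewrite eq_sym -subr_eq0 opprK.
have N_gt2 : (2 < N)%N.
  rewrite ltn_neqAle N_gt1 andbT; apply/eqP=> N2.
  by move: (oddX p s); rewrite -/N -N2 p_odd orbT.
rewrite -(natrD _ 1 1) => /eqP /(congr1 (@nat_of_ord _)).
by rewrite val_Zp_nat // modn_small.
Qed.

(* Otherwise [- h / k] would be 1 mod [p], and [-1] would lie in [H]. *)
Lemma index2_addN_unit h k : h \in H -> k \in H -> (p %| (val h + val k)%R)%N = false.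
Proof.
move=> hH kH; apply/negP=> pD.
have /multiplesP[z zE] : val h + val k \in multiples N p by rewrite inE.
have /negP[] := eNH.
have hkH : (h * k^-1)%g \in H by rewrite groupM ?groupV.
rewrite -(groupMr _ hkH).
apply: (index2_one_addM _ (- z / val k)) => /=.
rewrite mulN1r mulrA mulrN -zE opprD mulrDl !mulNr divrr ?(valP k) //.
by rewrite addrC subrK.
Qed.

(** Factor [p^i c h + p^(i+1) z] as [p^i c h (1 + p z / (c h))]; the last factor is 1 modulo [p],
    hence in [H]. *)
Lemma dilate_absorb i c y : y \in multiples N (p ^ i.+1) ->
  {in dilate H ((p ^ i)%:R * val c),
    forall x, x + y \in dilate H ((p ^ i)%:R * val c)}.
Proof.
move=> /multiplesP[z ->] _ /imsetP[h hH ->].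
set w := 1 + p%:R * (z / val (c * h)%g).
have wU : w \is a GRing.unit.
  by rewrite -(unitrX_pos _ (_ : 0 < p ^ s)%N) ?one_addM_pfactor ?unitr1 // ltnW.
have wH : FinRing.Unit wU \in H by apply: (index2_one_addM _ (z / val (c * h)%g)).
apply/imsetP; exists (h * FinRing.Unit wU)%g; first exact: groupM.
rewrite expnSr natrM -{1}(divrK (valP (c * h)%g) z) /= /w.
by move: (z / _) => t; rewrite !mulrDr mulr1 !mulrA; congr (_ + _); ring.
Qed.

(* The elements of valuation [i] are the disjoint union of the set and its
   opposite. *)
Lemma card_dilate i c : (i < s)%N ->
  #|dilate H ((p ^ i)%:R * val c)| = (totient (p ^ (s - i)) %/ 2)%N.
Proof.
move=> i_lt; set A := dilate _ _; pose B := [set - x | x in A].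
have cB : #|B| = #|A| by rewrite card_imset //; apply: oppr_inj.
have dAB : [disjoint A & B].
  apply/pred0P=> x /=; apply/negP=> /andP[/imsetP[h hH ->]].
  case/imsetP=> _ /imsetP[k kH ->] /eqP.
  rewrite -subr_eq0 opprK -mulrDr -mulrA.
  move=> /eqP /(dvdn_pfactorM_eq0 _ _ p_pr s_gt0 _ _ i_lt).
  apply/negP; rewrite -(unit_pfactor _ _ p_pr s_gt0) unitrM (valP c) /=.
  by rewrite (unit_pfactor _ _ p_pr s_gt0) index2_addN_unit.
have /(congr1 (fun A : {set _} => #|A|)) :
    A :|: B = multiples N (p ^ i) :\: multiples N (p ^ i.+1).
  apply/setP=> x; rewrite mulr_unit_layer // inE.
  apply/orP/existsP=> [[/imsetP[h _ ->]|/imsetP[_ /imsetP[h _ ->] ->]]|[u /eqP ->]].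
  - by exists (c * h)%g; rewrite /= mulrA.
  - by exists (e * c * h)%g; rewrite /= mulN1r mulNr mulrN mulrA.
  - case: (boolP ((c^-1 * u)%g \in H)) => [uH|uH].
      left; apply/imsetP; exists (c^-1 * u)%g => //=.
      by rewrite -mulrA mulVKr // (valP c).
    right; apply/imsetP; exists (- ((p ^ i)%:R * val u)); last by rewrite opprK.
    apply/imsetP; exists (e * (c^-1 * u))%g; first exact: index2_unit_mul.
    by rewrite /= mulN1r mulrN -mulrA mulVKr // (valP c).
rewrite card_layer // => <-; move: dAB; rewrite -leq_card_setU => /eqP ->.
by rewrite cB addnn -muln2 mulnK.
Qed.

End IndexTwo.

(** A positive order excludes the default value 0 given to non-invertible [k]. *)
Lemma mulord_gt0 m k : (0 < mulord m k)%N ->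
  exists2 u : {unit 'Z_m}, val u = k%:~R & #[u]%g = mulord m k.
Proof. by rewrite /mulord; case: insubP => //= u _ uE _; exists u. Qed.

(** * Factoring coset sums by the Chinese remainder theorem *)

Section CosetSum.
Variables (P Q l : nat) (lP : {unit 'Z_P}) (lQ : {unit 'Z_Q}).
Hypotheses (P_gt1 : (1 < P)%N) (Q_gt1 : (1 < Q)%N) (coPQ : coprime P Q).
Hypotheses (lPE : val lP = l%:R) (lQE : val lQ = l%:R).
Hypothesis coprime_order : coprime #[lP]%g #[lQ]%g.
Let n := (P * Q)%N.

Lemma mem_cyclotomic_coset gamma (x : 'I_n) :
  (x \in cyclotomic_coset l n gamma) =
  ((x : nat)%:R \in dilate <[lP]>%g gamma%:~R)
  && ((x : nat)%:R \in dilate <[lQ]>%g gamma%:~R).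
Proof.
have cosetE r : ((x : nat)%:Z = ((gamma * l%:Z ^+ r)%R %% n%:Z)%Z) <->
    (x : nat)%:R = gamma%:~R * val (lP ^+ r)%g /\
    (x : nat)%:R = gamma%:~R * val (lQ ^+ r)%g.
  apply: (@iff_trans _ (n %| (x : nat)%:Z - gamma * l%:Z ^+ r)%Z).
    rewrite -eqz_mod_dvd [X in X == _]modz_small ?ltz_nat ?ltn_ord //.
    by split=> /eqP.
  rewrite PoszM Gauss_dvdz ?coprimezE // -!Zp_int_eq0 //.
  rewrite !rmorphB /= !rmorphM !rmorphXn /=.
  rewrite !FinRing.val_unitX lPE lQE !subr_eq0.
  by split=> [/andP[/eqP ? /eqP ?]|[/eqP-> /eqP->]].
rewrite inE; apply/asboolP/andP=> [[r /cosetE[xP xQ]]|].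
  by split; apply/imsetP; [exists (lP ^+ r)%g | exists (lQ ^+ r)%g]; rewrite ?mem_cycle.
case=> /imsetP[_ /cycleP[r1 ->] xP] /imsetP[_ /cycleP[r2 ->] xQ].
(* The exponents [r1] and [r2] are unrelated; as the orders are coprime, one exponent is congruent
   to both. *)
exists (chinese #[lP]%g #[lQ]%g r1 r2); apply/cosetE; split.
  by rewrite xP -expg_mod_order -(chinese_modl coprime_order r1 r2) expg_mod_order.
by rewrite xQ -expg_mod_order -(chinese_modr coprime_order r1 r2) expg_mod_order.
Qed.

(** The exponents [chinese P Q 1 0] and [chinese P Q 0 1] are the idempotents of Z/n: if [x] has
    residues [a] and [b], then [x] is [a] times the first plus [b] times the second modulo [n]. *)
Lemma sum_cyclotomic_coset (R : comNzRingType) (z : R) gamma : z ^+ n = 1 ->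
  \sum_(a in cyclotomic_coset l n gamma) z ^+ a =
  power_sum R P (z ^+ chinese P Q 1 0) (dilate <[lP]>%g gamma%:~R)
  * power_sum R Q (z ^+ chinese P Q 0 1) (dilate <[lQ]>%g gamma%:~R).
Proof.
move=> zn; have P0 : (0 < P)%N := ltnW P_gt1; have Q0 : (0 < Q)%N := ltnW Q_gt1.
have n0 : (0 < n)%N by rewrite muln_gt0 P0.
have congr_expr x y : (x == y %[mod P])%N -> (x == y %[mod Q])%N -> z ^+ x = z ^+ y.
  move=> xP xQ; rewrite -(expr_mod x zn) -(expr_mod y zn); congr (_ ^+ _).
  by apply/eqP; rewrite chinese_remainder // xP.
rewrite /power_sum big_distrlr /= pair_big /=.
pose f (x : 'I_n) : 'Z_P * 'Z_Q := ((x : nat)%:R, (x : nat)%:R).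
pose g (ab : 'Z_P * 'Z_Q) : 'I_n := Ordinal (ltn_pmod (chinese P Q ab.1 ab.2) n0).
have natr_congr N (N1 : (1 < N)%N) x (a : 'Z_N) : (x%:R == a) = (x == a %[mod N])%N.
  rewrite -{1}(natr_Zp a) -(inj_eq val_inj); congr (_ == _); exact: val_Zp_nat.
rewrite (reindex f); last first.
  exists g => [x _|[a b] _].
    apply: val_inj; rewrite /= -[RHS](modn_small (ltn_ord x)).
    apply/eqP; rewrite chinese_remainder // chinese_modl // chinese_modr //.
    by rewrite !val_Zp_nat // !modn_mod !eqxx.
  congr (_, _); apply/eqP; rewrite natr_congr //=.
    by rewrite modn_dvdm ?dvdn_mulr // chinese_modl.
  by rewrite modn_dvdm ?dvdn_mull // chinese_modr.
apply: eq_big => [x|x _]; first by rewrite mem_cyclotomic_coset.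
rewrite -!exprM -exprD; apply: congr_expr => /=.
  rewrite -modnDm -modnMml chinese_modl // modnMml mul1n.
  rewrite -[(_ * _ %% P)%N]modnMml chinese_modl //.
  by rewrite mod0n mul0n mod0n addn0 modn_mod val_Zp_nat // modn_mod.
rewrite -modnDm -modnMml chinese_modr // mod0n mul0n mod0n add0n.
rewrite -[(_ * _ %% Q)%N]modnMml.
by rewrite chinese_modr // modnMml mul1n val_Zp_nat // !modn_mod.
Qed.

Lemma expr_chinese10 (R : comNzRingType) (z : R) : z ^+ n = 1 ->
  (z ^+ chinese P Q 1 0) ^+ P = 1.
Proof.
have : (Q %| chinese P Q 1 0)%N by rewrite /dvdn chinese_modr ?mod0n.
case/dvdnP=> r -> zn; rewrite -!exprM -mulnA [(Q * P)%N]mulnC mulnC exprM zn.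
exact: expr1n.
Qed.

Lemma expr_chinese01 (R : comNzRingType) (z : R) : z ^+ n = 1 ->
  (z ^+ chinese P Q 0 1) ^+ Q = 1.
Proof.
have : (P %| chinese P Q 0 1)%N by rewrite /dvdn chinese_modl ?mod0n.
case/dvdnP=> r -> zn; rewrite -!exprM -mulnA mulnC exprM zn.
exact: expr1n.
Qed.

End CosetSum.

(** The bookkeeping for the expanded square of [W j - W j.+1], with [x = W j], [y = W j.+1] and
    [a = q ^ (t - j - 1)]. *)
Lemma sqr_sub_mulrn (V : zmodType) (x y : V) q a : (1 < q)%N ->
  x *+ (q * a) - x *+ a - (x *+ a - y *+ a) =
  (x - y) *+ ((q - 2) * a) + y *+ ((q - 1) * a).
Proof.
case: q => [|[|q]] // _; rewrite subn2 subn1 /= !mulSn !mulrnDr mulrnBl opprB.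
rewrite [x *+ a + _]addrC -[_ + x *+ a]addrA addrCA !addrA.
by rewrite addrK [LHS]addrAC addrK [RHS]addrAC subrK.
Qed.

(** * Power sums over valuation layers modulo q^t *)

Section Layers.
Variables (q t : nat) (R : comNzRingType) (v : R).
Hypotheses (q_pr : prime q) (t_gt0 : (0 < t)%N).
Let Q := (q ^ t)%N.
Hypothesis vQ : v ^+ Q = 1.
Let Q_gt1 : (1 < Q)%N := pfactor_gt1 _ _ q_pr t_gt0.

Let W m := power_sum R Q v (multiples Q (q ^ m)).
Let V m (c : {unit 'Z_Q}) :=
  power_sum R Q v (dilate [set: {unit 'Z_Q}] ((q ^ m)%:R * val c)).

(** Multiplication by [c] permutes the units, so the sum runs over all elements of exact valuation
    [m], whatever [c] is. *)
Lemma power_sum_layer m c : (m < t)%N -> V m c = W m - W m.+1.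
Proof.
move=> mt; rewrite -power_sumD ?multiples_sub ?dvdn_exp2l //; congr power_sum.
apply/setP=> x; rewrite mulr_unit_layer //.
apply/imsetP/existsP => [[h _ ->]|[u /eqP ->]].
  by exists (c * h)%g; rewrite /= mulrA.
by exists (c^-1 * u)%g; rewrite // -mulrA mulVKr ?(valP c).
Qed.

Lemma power_sum_layer_last c : V t c = W t.
Proof.
congr power_sum; apply/setP=> x; rewrite -/Q pchar_Zp // mul0r inE.
apply/imsetP/idP=> [[h _ ->]|]; first by rewrite mul0r dvdn0.
move=> Qx; exists 1%g; rewrite ?inE // mul0r -(natr_Zp x).
have xQ : (x < Q)%N by rewrite -[ltnRHS](Zp_cast Q_gt1) ltn_ord.
by rewrite -(modn_small xQ) (eqP (Qx : _ == _)).
Qed.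

(** The larger ideal is stable under translation by the smaller one, which has [q ^ (t - k)]
    elements. *)
Lemma power_sum_multiplesM m k : (m <= k <= t)%N -> W m * W k = W m *+ q ^ (t - k).
Proof.
case/andP=> mk kt; rewrite power_sumM //.
  by rewrite card_multiples ?dvdn_exp2l // -expnB ?prime_gt0.
move=> a b aW bW; apply: multiplesD => //.
  by rewrite dvdn_exp2l // (leq_trans mk).
by apply: (subsetP (multiples_sub _ _ _ _)) bW; rewrite dvdn_exp2l.
Qed.

(** The sum telescopes, the last layer being the zero ideal. The unit may vary with [m], which
    allows [chi] and [chi_star] terms to be mixed. *)
Lemma sum_layers j (c : nat -> {unit 'Z_Q}) : (j < t)%N ->
  \sum_(j.+1 <= m < t.+1) V m (c m) = W j.+1.
Proof.
move=> jt; rewrite big_nat_recr //= power_sum_layer_last.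
rewrite (telescope_sumr_eq (fun m => - W m)) // ?opprK //.
  by rewrite addrAC addNr add0r.
by move=> k /andP[_ kt]; rewrite power_sum_layer // opprK addrC.
Qed.

Lemma power_sum_layer_sqr j c c' : (j < t)%N ->
  V j c * V j c' =
  V j c *+ ((q - 2) * q ^ (t - j - 1)) + W j.+1 *+ totient (q ^ (t - j)).
Proof.
move=> jt; rewrite !power_sum_layer // mulrBl !mulrBr ![W j.+1 * W j]mulrC.
rewrite !power_sum_multiplesM ?leqnn ?leqnSn ?(ltnW jt) //.
rewrite totient_pfactor ?subn_gt0 // -subn1 -!subnDA addn1.
rewrite subnS -subn1 -[in (q ^ (t - j))%N](subnK (_ : 1 <= t - j)%N) ?subn_gt0 //.
rewrite addn1 expnS; apply: sqr_sub_mulrn; exact: prime_gt1.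
Qed.

End Layers.

Lemma qpolyX_Xnsub1 (R : comNzRingType) n : (0 < n)%N ->
  ('qX : {poly %/ ('X^n - 1 : {poly R})}) ^+ n = 1.
Proof.
(* For [n > 0] the modulus is monic and non-constant, so [mk_monic] does not replace it by its
   default. *)
move=> n0; set h := 'X^n - 1; have hE : mk_monic h = h.
  by rewrite /mk_monic /h -polyC1 size_XnsubC // monicXnsubC // ltnS n0.
rewrite /qpolyX -rmorphXn /= -[_ ^+ n](subrK 1) rmorphD /= in_qpoly1 -/h.
rewrite -[RHS]add0r; congr (_ + _); apply: val_inj => /=.
by rewrite hE Pdiv.RingMonic.rmodpp // -hE monic_mk_monic.
Qed.

(** * Quadratic character of q and membership in H *)

Section Residues.
Variables (p s : nat).
Hypotheses (p_pr : prime p) (p_odd : odd p) (s_gt0 : (0 < s)%N).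
Let N := (p ^ s)%N.
Variable H : {group {unit 'Z_N}}.
Hypotheses (H_odd : odd #|H|) (cardH : totient N = (2 * #|H|)%N).
Variables (q : nat) (u : {unit 'Z_N}).
Hypothesis uE : val u = q%:R.
Let N_gt1 : (1 < N)%N := pfactor_gt1 _ _ p_pr s_gt0.

Lemma quadratic_residue_index2 : quadratic_residue q p -> u \in H.
Proof.
case=> co_qp [x xq].
have xU : (x%:R : 'Z_N) \is a GRing.unit.
  rewrite unitZpE // coprime_pexpl // coprime_sym -(coprime_pexpl _ _ (ltn0Sn 1)).
  by rewrite -coprime_modl xq coprime_modl.
set w := FinRing.Unit xU; rewrite -(mulgKV (w ^+ 2)%g u) groupM ?index2_unit_sqr //.
(* Only [x^2 = q] modulo [p] is known. As the remainders agree, [q - x^2 = p y] modulo [p^s], so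
   [q / x^2] is 1 modulo [p] and lies in [H]. *)
pose y : 'Z_N := (q %/ p)%:R - (x ^ 2 %/ p)%:R.
apply: (index2_one_addM p s p_pr p_odd s_gt0 H cardH _ (y / val (w ^+ 2)%g)) => //.
rewrite FinRing.val_unitM FinRing.val_unitV.
rewrite -[X in X + _](divrr (valP (w ^+ 2)%g)) mulrA -mulrDl /y.
congr (_ / _); rewrite FinRing.val_unitX /= -natrX uE.
rewrite {1}(divn_eq q p) {1}(divn_eq (x ^ 2) p) xq.
rewrite !natrD !natrM; ring.
Qed.

Lemma quadratic_nonresidue_index2 : quadratic_nonresidue q p -> u \notin H.
Proof.
case=> co_qp nx; apply/negP=> uH; apply: nx.
set w := (u ^+ (#|H|.+1)./2)%g; exists (val w : nat).
(* As [H] has odd order, [u = u ^+ #|H|.+1] is a square. *)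
have w2 : (w ^+ 2 = u)%g.
  rewrite -expgM muln2 halfK /= H_odd subn0 expgS.
  by rewrite expg_cardG // mulg1.
have : (val w) ^+ 2 = q%:R by rewrite -FinRing.val_unitX w2.
rewrite -{1}(natr_Zp (val w)) -natrX => /(congr1 (@nat_of_ord _)).
rewrite !val_Zp_nat // => /(congr1 (modn^~ p)).
by rewrite !modn_dvdm // dvdn_exp.
Qed.

End Residues.

(** * The two product formulas *)

Theorem theorem4p14 (s t p q l : nat) (g : int)
    (hs : (1 <= s)%N) (ht : (1 <= t)%N)
    (hp : prime p) (hq : prime q) (hl : prime l)
    (hpq : p <> q) (hpl : p <> l) (hql : q <> l)
    (hpodd : odd p) (hqodd : odd q) (hp34 : (p = 3 %[mod 4])%N)
    (hordp : mulord (p ^ s) l%:Z = (totient (p ^ s) %/ 2)%N)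
    (hordq : mulord (q ^ t) l%:Z = totient (q ^ t))
    (hgcd : gcdn (totient (p ^ s)) (totient (q ^ t)) = 2%N)
    (hgp : primitive_root_mod (p ^ s) g)
    (hgq : primitive_root_mod (q ^ t) g)
    (i i' j : nat)
    (hii' : (i < i')%N) (hi' : (i' <= s - 1)%N) (hj : (j <= t - 1)%N) :
  let X := chi p s q t l in
  let X' := chi_star p s q t l g in
  let a := (totient (p ^ (s - i')) %/ 2 * (q - 2) * q ^ (t - j - 1))%N in
  let b := (totient (p ^ (s - i')) %/ 2 * totient (q ^ (t - j)))%N in
  (quadratic_residue q p ->
     X' i j * X' i' j
     = (a%:R : 'F_l) *: X' i j
       + (b%:R : 'F_l) *: \sum_(j.+1 <= m < t.+1) X' i m)
  /\
  (quadratic_nonresidue q p ->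
     X' i j * X' i' j
     = (a%:R : 'F_l) *: X' i j
       + (b%:R : 'F_l) *:
           (\sum_(j.+1 <= m < t.+1 | ~~ (2 %| m - j)%N) X i m
            + \sum_(j.+1 <= m < t.+1 | (2 %| m - j)%N) X' i m)).
Proof.
set P := (p ^ s)%N; set Q := (q ^ t)%N => X X' a b.
have P_gt1 : (1 < P)%N := pfactor_gt1 _ _ hp hs.
have Q_gt1 : (1 < Q)%N := pfactor_gt1 _ _ hq ht.
have co_pq : coprime p q by rewrite prime_coprime // dvdn_prime2 //; apply/eqP.
have coPQ : coprime P Q by rewrite coprimeXl // coprimeXr.
have totPE : totient P = (2 * (totient P %/ 2))%N.
  by rewrite mulnC divnK // -hgcd dvdn_gcdl.
have totP_gt0 : (0 < totient P %/ 2)%N.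
  by rewrite divn_gt0 // dvdn_leq ?totient_gt0 ?(ltnW P_gt1) // -hgcd dvdn_gcdl.
(* This is where [p = 3] modulo 4 enters: it makes [(p - 1) / 2] odd. *)
have totP_odd : odd (totient P %/ 2).
  have pE : p.-1 = (2 * (2 * (p %/ 4) + 1))%N.
    by rewrite {1}(divn_eq p 4) hp34 mulnDr mulnA addnS mulnC.
  rewrite totient_pfactor // pE -mulnA mulKn // oddM oddD mul2n odd_double /=.
  by rewrite oddX hpodd orbT.
(* A common divisor is odd and divides the gcd 2 of the two totients. *)
have coO : coprime (totient P %/ 2) (totient Q).
  rewrite /coprime; set d := gcdn _ _.
  have d_odd : odd d := dvdn_odd (dvdn_gcdl _ _) totP_odd.
  have d2 : (d %| 2)%N.
    by rewrite -hgcd dvdn_gcd dvdn_gcdr andbT -/P totPE dvdn_mull // dvdn_gcdl.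
  by have /orP[//|/eqP dE] := proj2 (primeP (isT : prime 2)) d d2; rewrite dE in d_odd.
have [lP lPE olP] := mulord_gt0 P l%:Z ltac:(by rewrite hordp).
have [lQ lQE olQ] := mulord_gt0 Q l%:Z ltac:(by rewrite hordq totient_gt0 ltnW).
have [gP gPE ogP] := mulord_gt0 P g ltac:(by rewrite (proj2 hgp) totient_gt0 ltnW).
have [gQ gQE ogQ] := mulord_gt0 Q g ltac:(by rewrite (proj2 hgq) totient_gt0 ltnW).
have qP : (q%:R : 'Z_P) \is a GRing.unit by rewrite unitZpE // coprimeXl.
have pQ : (p%:R : 'Z_Q) \is a GRing.unit by rewrite unitZpE // coprime_sym coprimeXr.
set uq : {unit 'Z_P} := FinRing.Unit qP; set up : {unit 'Z_Q} := FinRing.Unit pQ.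
set H := <[lP]>%G.
have cardHE : #|H| = (totient P %/ 2)%N by rewrite [#|_|]olP hordp.
have H_odd : odd #|H| by rewrite cardHE.
have cardH : totient P = (2 * #|H|)%N by rewrite cardHE.
have HQ : <[lQ]>%g = [set: {unit 'Z_Q}].
  apply/eqP; rewrite eqEcard subsetT.
  by rewrite (card_units_Zp (ltnW Q_gt1) : #|[set: {unit 'Z_Q}]| = _) [#|_|]olQ hordq /=.
(* A generator of all units cannot lie in a subgroup of index 2. *)
have gPH : gP \notin H.
  apply/negP=> gH; have := subset_leq_card (_ : <[gP]>%g \subset H).
  rewrite cycle_subG gH => /(_ isT); rewrite [#|<[_]>%g|]ogP (proj2 hgp) cardHE.
  by rewrite -/P {1}totPE leqNgt mul2n -addnn -{1}[(_ %/ _)%N]addn0 ltn_add2l totP_gt0.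
set z : {poly %/ ('X^(P * Q) - 1 : {poly 'F_l})} := 'qX.
have zn : z ^+ (P * Q) = 1.
  by apply: qpolyX_Xnsub1; rewrite muln_gt0 (ltnW P_gt1) (ltnW Q_gt1).
pose U c := power_sum _ P (z ^+ chinese P Q 1 0) (dilate H c).
pose V m (c : {unit 'Z_Q}) :=
  power_sum _ Q (z ^+ chinese P Q 0 1) (dilate [set: {unit 'Z_Q}] ((q ^ m)%:R * val c)).
have uP := expr_chinese10 _ _ coPQ _ _ zn.
have vQ := expr_chinese01 _ _ coPQ _ _ zn.
have coO' : coprime #[lP]%g #[lQ]%g by rewrite olP olQ hordp hordq.
(* Modulo [P] the power of [q] is a unit, and modulo [Q] the power of [p] is. *)
have cP i0 m : (p ^ i0 * q ^ m)%N%:Z%:~R = (p ^ i0)%:R * val (uq ^+ m)%g :> 'Z_P.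
  by rewrite -pmulrn natrM natrX natrX FinRing.val_unitX.
have cQ i0 m : (p ^ i0 * q ^ m)%N%:Z%:~R = (q ^ m)%:R * val (up ^+ i0)%g :> 'Z_Q.
  by rewrite -pmulrn mulnC natrM natrX natrX FinRing.val_unitX.
have XE i0 m : X i0 m = U ((p ^ i0)%:R * val (uq ^+ m)%g) * V m (up ^+ i0)%g.
  rewrite /X /chi /coset_sum (sum_cyclotomic_coset _ _ _ lP lQ) //.
  by rewrite HQ cP cQ.
have X'E i0 m : X' i0 m = U ((p ^ i0)%:R * val (uq ^+ m * gP)%g) * V m (up ^+ i0 * gQ)%g.
  rewrite /X' /chi_star /coset_sum (sum_cyclotomic_coset _ _ _ lP lQ) //.
  by rewrite HQ !intrM cP cQ -gPE -gQE -!mulrA.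
have jt : (j < t)%N by rewrite -(subnK ht) addn1 ltnS.
have i's : (i' < s)%N by rewrite -(subnK hs) addn1 ltnS.
set A := U ((p ^ i)%:R * val (uq ^+ j * gP)%g).
pose W := power_sum _ Q (z ^+ chinese P Q 0 1) (multiples Q (q ^ j.+1)).
(* Common to both cases; what remains is to expand [A * W] into coset sums. *)
have XX : X' i j * X' i' j = (a%:R : 'F_l) *: X' i j + (b%:R : 'F_l) *: (A * W).
  rewrite !scaler_nat !X'E mulrACA power_sum_layer_sqr //.
  rewrite power_sumM //; last first.
    move=> x y xA /imsetP[h _ ->]; apply: dilate_absorb => //.
    rewrite -mulrA; apply: (subsetP (multiples_sub _ _ (p ^ i') _)).
      exact: dvdn_exp2l.
    by apply: multiplesMn => //; rewrite dvdn_exp2l // ltnW.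
  rewrite card_dilate // -/W -/(U _) -/A -!/(V _ _).
  by rewrite mulrDr !mulrnAr !mulrnAl -!mulrnA /a /b mulnA.
have UqH c h : h \in H -> c = (uq ^+ j * gP * h)%g -> U ((p ^ i)%:R * val c) = A.
  move=> hH ->; rewrite /A /U; congr power_sum.
  by rewrite FinRing.val_unitM mulrA dilate_eq.
have sumA (f : nat -> {unit 'Z_Q}) : A * W = \sum_(j.+1 <= m < t.+1) A * V m (f m).
  by rewrite -big_distrr /= sum_layers.
have uqD m : (j < m)%N -> (uq ^+ m = uq ^+ j * uq ^+ (m - j))%g.
  by move=> jm; rewrite -expgD subnKC // ltnW.
have uqHE k : ~~ odd k -> (uq ^+ k)%g \in H.
  move=> k_even; rewrite -(odd_double_half k) (negPf k_even) add0n -mul2n expgM.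
  by rewrite groupX // index2_unit_sqr.
have UqD m : (uq ^+ (m - j))%g \in H -> (j < m)%N ->
    U ((p ^ i)%:R * val (uq ^+ m * gP)%g) = A.
  move=> kH jm; apply: (UqH _ _ kH); apply: val_inj.
  by rewrite uqD // !FinRing.val_unitM mulrAC.
split=> hqp; rewrite XX; congr (_ + _ *: _).
  have uqH : uq \in H by apply: quadratic_residue_index2 hqp.
  rewrite (sumA (fun=> (up ^+ i * gQ)%g)); apply: eq_big_nat => m /andP[jm _].
  by rewrite X'E UqD // groupX.
have uqH : uq \notin H by apply: quadratic_nonresidue_index2 hqp.
(* The units are chosen to match the factor modulo [Q] of [X' i m] for even [m - j] and of [X i m]
   for odd [m - j]. *)
rewrite (sumA (fun m => if (2 %| m - j)%N then up ^+ i * gQ else up ^+ i)%g).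
rewrite (bigID (fun m => ~~ (2 %| m - j)%N)) /=; congr (_ + _).
  rewrite big_nat_cond [RHS]big_nat_cond; apply: eq_bigr => m /andP[/andP[jm _] d].
  rewrite (negPf d) XE; congr (_ * _); symmetry.
  have oddk : odd (m - j) by rewrite dvdn2 negbK in d.
  have kH : (uq ^+ (m - j))%g \notin H.
    rewrite -(odd_double_half (m - j)) oddk expgS -mul2n expgM.
    by rewrite groupMr // groupX // index2_unit_sqr.
  have gVH : (gP^-1)%g \notin H by rewrite groupV.
  (* Both factors lie outside [H], so [q^m = q^j g (g^-1 q^(m-j))] lies in [q^j g H]: hence [chi]
     rather than [chi_star]. *)
  have hH : (gP^-1 * uq ^+ (m - j))%g \in H by apply: index2_unit_mul.
  by apply: (UqH _ _ hH); rewrite mulgA mulgK uqD.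
rewrite big_nat_cond [RHS]big_nat_cond; apply: eq_big => [m|m].
  by rewrite negbK.
rewrite negbK => /andP[/andP[jm _] d]; rewrite d X'E UqD //.
by apply: uqHE; rewrite -dvdn2.
Qed.
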